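(* Let $L_1$ and $L_2$ be context-free languages. Then $GSA(L_1,L_2)$ is a context-free language.
   Context: For words $w_1,w_2$ and a nonempty word $x$ that is a substring of both, $GSA_x(w_1,w_2)=\{u_1xv_1,u_2xv_2,u_1xv_2,u_2xv_1 : w_1=u_1xv_1,\ w_2=u_2xv_2\}$ over all such factorizations; $GSA(w_1,w_2)=\bigcup_x GSA_x(w_1,w_2)$ over all nonempty common substrings $x$; and $GSA(L_1,L_2)=\bigcup_{w_1\in L_1,w_2\in L_2}GSA(w_1,w_2)$. *)

(* Defs.v *)
From Stdlib Require Export Relation_Operators.
From mathcomp Require Export all_boot.
From mathcomp Require Export classical_sets.

Set Implicit Arguments.
Unset Strict Implicit.
Unset Printing Implicit Defensive.

Local Open Scope classical_set_scope.

(* Words over the finite alphabet T are elements of seq T, and languages are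
   elements of set (seq T). *)

(* A sentential form is a word over N + T: inl for nonterminals, inr for
   terminals. Right-hand sides of productions may be empty. *)
Record cfg (T : finType) : Type := Cfg {
  nonterminal : finType;
  start : nonterminal;
  productions : seq (nonterminal * seq (nonterminal + T))
}.

Definition cfg_step (T : finType) (G : cfg T)
    (s t : seq (nonterminal G + T)) : Prop :=
  exists (u v : seq (nonterminal G + T)) (A : nonterminal G)
         (r : seq (nonterminal G + T)),
    [/\ (A, r) \in productions G,
        s = u ++ inl A :: v
      & t = u ++ r ++ v].

Definition cfg_derives (T : finType) (G : cfg T) :
    seq (nonterminal G + T) -> seq (nonterminal G + T) -> Prop :=
  clos_refl_trans _ (@cfg_step T G).

Definition cfg_language (T : finType) (G : cfg T) : set (seq T) :=
  [set w | cfg_derives [:: inl (start G)] [seq inr a | a <- w]].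

Definition context_free (T : finType) (L : set (seq T)) : Prop :=
  exists G : cfg T, L = cfg_language G.

Definition GSA_at (T : finType) (x w1 w2 : seq T) : set (seq T) :=
  [set w | exists u1 v1 u2 v2 : seq T,
    [/\ w1 = u1 ++ x ++ v1,
        w2 = u2 ++ x ++ v2
      & w \in [:: u1 ++ x ++ v1; u2 ++ x ++ v2;
                  u1 ++ x ++ v2; u2 ++ x ++ v1]]].

Definition GSA_words (T : finType) (w1 w2 : seq T) : set (seq T) :=
  \bigcup_(x in [set y | [/\ y <> [::], infix y w1 & infix y w2]])
    GSA_at x w1 w2.

Definition GSA (T : finType) (L1 L2 : set (seq T)) : set (seq T) :=
  \bigcup_(w1 in L1) \bigcup_(w2 in L2) GSA_words w1 w2.

(* Main.v *)
Require Import Defs.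
From mathcomp Require Import boolp.

Set Implicit Arguments.
Unset Strict Implicit.
Unset Printing Implicit Defensive.

(** If [w1 = u1 x v1] and [w2 = u2 x v2] with [x = a y], then [u1 x v2] is
    also the crossover of [w1] and [w2] at the single letter [a].  Hence
    [GSA L1 L2] is the union over the letters [a] of the words of [L1]
    containing [a] (if some word of [L2] contains [a]), of the products of
    { u a | u a v in L1 } and { v | u a v in L2 }, and of the same languages
    with [L1] and [L2] exchanged.  Each factor is the image of a context-free
    language under a two-state automaton that may erase the letters it reads,
    and context-free languages are closed under such images by the triple
    construction. *)

Local Open Scope classical_set_scope.

(** * Derivation forests in place of rewriting sequences *)

Inductive yields (T : finType) (G : cfg T) :
    seq (nonterminal G + T) -> seq T -> Prop :=
| yields_nil : yields [::] [::]
| yields_terminal a s w : yields s w -> yields (inr a :: s) (a :: w)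
| yields_nonterminal A r s w1 w2 : (A, r) \in productions G ->
    yields r w1 -> yields s w2 -> yields (inl A :: s) (w1 ++ w2).

Section Yields.
Variables (T : finType) (G : cfg T).
Implicit Types (s t u v : seq (nonterminal G + T)) (w : seq T).

Lemma yields_cat s1 s2 w1 w2 :
  yields s1 w1 -> yields s2 w2 -> yields (s1 ++ s2) (w1 ++ w2).
Proof.
move=> y1 y2; elim: y1 => //= [a s w _|A r s v1 v2 Ar yr _ _ IH].
  exact: yields_terminal.
by rewrite -catA; apply: yields_nonterminal Ar yr IH.
Qed.

Lemma yields_split s1 s2 w : yields (s1 ++ s2) w ->
  exists w1 w2, [/\ w = w1 ++ w2, yields s1 w1 & yields s2 w2].
Proof.
elim: s1 w => [|X s1 IH] w /=; first by exists [::], w; split=> //; constructor.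
move=> y; inversion y as [|a s v ys eX ev|A r s v1 v2 Ar yr ys eX ev]; subst.
  have [w1 [w2 [-> y1 y2]]] := IH _ ys.
  by exists (a :: w1), w2; split=> //; constructor.
have [w1 [w2 [-> y1 y2]]] := IH _ ys.
exists (v1 ++ w1), w2; split=> //; first by rewrite catA.
exact: yields_nonterminal Ar yr y1.
Qed.

Lemma yields_single A w : yields [:: inl A : nonterminal G + T] w <->
  exists2 r, (A, r) \in productions G & yields r w.
Proof.
split=> [y|[r Ar yr]].
  inversion y as [| |B r s v1 v2 Ar yr ys eX ev]; subst.
  by inversion ys; subst; rewrite cats0; exists r.
by rewrite -[w]cats0; apply: yields_nonterminal Ar yr _; constructor.
Qed.

Lemma yields_word w : yields [seq inr a : nonterminal G + T | a <- w] w.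
Proof. by elim: w => [|a w IH] /=; constructor. Qed.

Lemma yields_step s t w : cfg_step s t -> yields t w -> yields s w.
Proof.
move=> [u [v [A [r [Ar -> ->]]]]].
move=> /yields_split [w1 [_ [-> yu /yields_split [w2 [w3 [-> yr yv]]]]]].
by apply: yields_cat yu _; apply: yields_nonterminal Ar yr yv.
Qed.

Lemma derives_context u v s t :
  cfg_derives s t -> cfg_derives (u ++ s ++ v) (u ++ t ++ v).
Proof.
elim=> [_ _ [u' [v' [A [r [Ar -> ->]]]]]|s'|s1 s2 s3 _ IH12 _ IH23].
- apply: rt_step; exists (u ++ u'), (v' ++ v), A, r; split=> //;
    by rewrite -!catA.
- exact: rt_refl.
- exact: rt_trans IH12 IH23.
Qed.

(** Reading the forest in preorder gives a leftmost derivation: a leading nonterminal is rewritten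
    down to terminals before the rest of the form is touched. *)
Lemma yields_derives s w : yields s w -> cfg_derives s [seq inr a | a <- w].
Proof.
elim=> [|a s' w' _ IH|A r s' w1 w2 Ar _ IHr _ IHs].
- exact: rt_refl.
- by have := derives_context [:: inr a] [::] IH; rewrite !cats0.
- apply: (rt_trans _ _ _ (r ++ s')).
    by apply: rt_step; exists [::], s', A, r.
  apply: (rt_trans _ _ _ ([seq inr a | a <- w1] ++ s')).
    exact: (derives_context [::] s' IHr).
  rewrite map_cat.
  by have := derives_context [seq inr a | a <- w1] [::] IHs; rewrite !cats0.
Qed.

Lemma derives_yields s t w : cfg_derives s t -> yields t w -> yields s w.
Proof.
elim=> [s1 s2|//|s1 s2 s3 _ IH12 _ IH23 y]; first exact: yields_step.
exact/IH12/IH23.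
Qed.

(** A terminal word yields itself, and [yields] can be carried backwards along a rewriting sequence.
    From here on, grammars are studied by induction on forests only. *)
Lemma cfg_languageE w : cfg_language G w <-> yields [:: inl (start G)] w.
Proof.
split; last exact: yields_derives.
by move/derives_yields; apply; apply: yields_word.
Qed.

End Yields.

Lemma context_freeP (T : finType) (G : cfg T) (L : set (seq T)) :
  (forall w, L w <-> yields [:: inl (start G)] w) -> context_free L.
Proof.
move=> LG; exists G; apply/predeqP => w.
by rewrite LG; split=> /cfg_languageE.
Qed.

(** * Sums of grammars; closure under union and product *)

Definition map_nonterminal (T N N' : Type) (f : N -> N') (X : N + T) : N' + T :=
  match X with inl A => inl (f A) | inr a => inr a end.

(** By the hypothesis on productions, a derivation that starts in the image of [f] never leaves it,
    so it can be pulled back node by node. *)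
Lemma yields_map_nonterminal (T : finType) (G G' : cfg T)
    (f : nonterminal G -> nonterminal G') :
  (forall A r', (f A, r') \in productions G' <->
     exists2 r, (A, r) \in productions G & r' = map (map_nonterminal f) r) ->
  forall s w, yields (map (map_nonterminal f) s) w <-> yields s w.
Proof.
move=> prodf s w; split=> y.
  move es: (map _ s) y => s' y; elim: y s es => {s' w}.
  - by case=> // _; constructor.
  - move=> a s' w _ IH [|[A|b] s] //= [<- es].
    by constructor; apply: IH.
  - move=> A' r' s' w1 w2 Ar' _ IHr _ IHs [|[A|b] s] //= [eA es].
    move: Ar'; rewrite -eA => /prodf[r Ar er].
    by apply: (yields_nonterminal Ar); [apply: IHr | apply: IHs].
elim: y => [|a s' w' _ IH|A r s' w1 w2 Ar _ IHr _ IHs] /=; try by constructor.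
by apply: yields_nonterminal IHr IHs; apply/prodf; exists r.
Qed.

Section Sum.
Variables (T : finType) (G1 G2 : cfg T).

(** [None] is a fresh start symbol. Its right-hand sides [rhs] stay a parameter below: two
    alternatives give the union, a single concatenation gives the product. *)
Definition sum_nonterminal : finType :=
  option (nonterminal G1 + nonterminal G2).
Definition sum_inl (A : nonterminal G1) : sum_nonterminal := Some (inl A).
Definition sum_inr (A : nonterminal G2) : sum_nonterminal := Some (inr A).

Variable rhs : seq (seq (sum_nonterminal + T)).

Definition sum_cfg : cfg T := @Cfg T sum_nonterminal None
  ([seq (None, r) | r <- rhs] ++
   [seq (sum_inl p.1, map (map_nonterminal sum_inl) p.2)
     | p <- productions G1] ++
   [seq (sum_inr p.1, map (map_nonterminal sum_inr) p.2)
     | p <- productions G2]).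

Lemma yields_sum_inl s w :
  @yields T sum_cfg (map (map_nonterminal sum_inl) s) w <-> yields s w.
Proof.
apply: (@yields_map_nonterminal T G1 sum_cfg sum_inl) => A r'.
rewrite !mem_cat; split=> [/or3P[] /mapP[]//|[r Ar ->]].
  by move=> [B r] Br [-> ->]; exists r.
by apply/or3P/Or32/mapP; exists (A, r).
Qed.

Lemma yields_sum_inr s w :
  @yields T sum_cfg (map (map_nonterminal sum_inr) s) w <-> yields s w.
Proof.
apply: (@yields_map_nonterminal T G2 sum_cfg sum_inr) => A r'.
rewrite !mem_cat; split=> [/or3P[] /mapP[]//|[r Ar ->]].
  by move=> [B r] Br [-> ->]; exists r.
by apply/or3P/Or33/mapP; exists (A, r).
Qed.

Lemma yields_sum_start w : yields [:: inl (start sum_cfg)] w <->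
  exists2 r, r \in rhs & @yields T sum_cfg r w.
Proof.
rewrite yields_single; split=> -[r rP y]; exists r => //.
  by move: rP; rewrite !mem_cat => /or3P[] /mapP[]// r' ? [->].
by rewrite mem_cat; apply/orP; left; apply/mapP; exists r.
Qed.

End Sum.

Lemma context_free_setU (T : finType) (L1 L2 : set (seq T)) :
  context_free L1 -> context_free L2 -> context_free (L1 `|` L2).
Proof.
move=> [G1 ->] [G2 ->].
set r1 : seq (sum_nonterminal G1 G2 + T) :=
  map (map_nonterminal (@sum_inl T G1 G2)) [:: inl (start G1)].
set r2 : seq (sum_nonterminal G1 G2 + T) :=
  map (map_nonterminal (@sum_inr T G1 G2)) [:: inl (start G2)].
apply: (@context_freeP _ (sum_cfg [:: r1; r2])) => w.
rewrite yields_sum_start; split.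
  case=> /cfg_languageE y; [exists r1 | exists r2]; rewrite ?inE ?eqxx ?orbT //.
    exact/yields_sum_inl.
  exact/yields_sum_inr.
move=> [r]; rewrite !inE => /orP[]/eqP->.
  by move/yields_sum_inl => ?; left; apply/cfg_languageE.
by move/yields_sum_inr => ?; right; apply/cfg_languageE.
Qed.

Lemma context_free_cat (T : finType) (L1 L2 : set (seq T)) :
  context_free L1 -> context_free L2 ->
  context_free [set w1 ++ w2 | w1 in L1 & w2 in L2].
Proof.
move=> [G1 ->] [G2 ->].
set r1 : seq (sum_nonterminal G1 G2 + T) :=
  map (map_nonterminal (@sum_inl T G1 G2)) [:: inl (start G1)].
set r2 : seq (sum_nonterminal G1 G2 + T) :=
  map (map_nonterminal (@sum_inr T G1 G2)) [:: inl (start G2)].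
apply: (@context_freeP _ (sum_cfg [:: r1 ++ r2])) => w.
rewrite yields_sum_start; split.
  move=> [w1 /cfg_languageE y1 [w2 /cfg_languageE y2 <-]].
  exists (r1 ++ r2); rewrite ?inE //.
  by apply: yields_cat; [apply/yields_sum_inl | apply/yields_sum_inr].
move=> [r]; rewrite inE => /eqP-> /yields_split[w1 [w2 [-> y1 y2]]].
exists w1; first by move/yields_sum_inl: y1 => /cfg_languageE.
by exists w2 => //; move/yields_sum_inr: y2 => /cfg_languageE.
Qed.

Lemma context_free_set0 (T : finType) : context_free (@set0 (seq T)).
Proof.
apply: (@context_freeP _ (@Cfg T unit tt [::])) => w.
by split=> // /yields_single[].
Qed.

(** Meant for [P] saying that the other language has a word with the given letter. Excluded middle
    leaves either [L] or the empty language. *)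
Lemma context_free_guard (T : finType) (P : Prop) (L : set (seq T)) :
  context_free L -> context_free [set w | P /\ L w].
Proof.
move=> cfL; have [p|np] := pselect P.
  by rewrite (_ : mkset _ = L) //; apply/predeqP => w; split=> [[]|].
rewrite (_ : mkset _ = set0); first exact: context_free_set0.
by apply/predeqP => w; split=> [[]|].
Qed.

Lemma context_free_bigcup (T I : finType) (L : I -> set (seq T)) :
  (forall i, context_free (L i)) -> context_free (\bigcup_i L i).
Proof.
move=> cfL; rewrite (_ : bigcup _ _ = \big[setU/set0]_(i <- enum I) L i).
  elim/big_ind: _ => //; first exact: context_free_set0.
  by move=> ? ?; apply: context_free_setU.
rewrite -bigcup_seq; apply/predeqP => w.
by split=> -[i _ Liw]; exists i => //=; rewrite mem_enum.
Qed.

(** * Images under erasing automata by the triple construction *)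

(** [(q, b) \in delta p a]: in state [p] the automaton can read [a] and move to
    [q], copying [a] to the output if [b] is true and erasing it otherwise. *)
Section ErasingAutomaton.
Variables (T Q : finType) (delta : Q -> T -> seq (Q * bool)).

Fixpoint run (p : Q) (w : seq T) (q : Q) (out : seq T) : Prop :=
  if w is a :: v then
    exists m b out', [/\ (m, b) \in delta p a, run m v q out'
                       & out = nseq b a ++ out']
  else p = q /\ out = [::].

Lemma run_cat p m q w1 w2 o1 o2 :
  run p w1 m o1 -> run m w2 q o2 -> run p (w1 ++ w2) q (o1 ++ o2).
Proof.
elim: w1 p o1 => [|a w1 IH] p o1 /=; first by move=> [-> ->].
move=> [n [b [o [d r1 ->]]]] r2; exists n, b, (o ++ o2); split=> //.
  exact: IH.
by rewrite catA.
Qed.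

Lemma run_split p q w1 w2 o : run p (w1 ++ w2) q o ->
  exists m o1 o2, [/\ run p w1 m o1, run m w2 q o2 & o = o1 ++ o2].
Proof.
elim: w1 p o => [|a w1 IH] p o /=; first by move=> r; exists p, [::], o.
move=> [n [b [o' [d /IH[m [o1 [o2 [r1 r2 ->]]]] ->]]]].
exists m, (nseq b a ++ o1), o2; split=> //; last by rewrite catA.
by exists n, b, o1.
Qed.

Variable G : cfg T.

(** As in the Bar-Hillel construction, [(p, A, m)] is to generate the outputs of the runs from [p]
    to [m] on words generated by [A]. The states between consecutive symbols are guessed, and each
    terminal is replaced at once by its output. *)
Fixpoint annotate (p : Q) (s : seq (nonterminal G + T)) (q : Q) :
    seq (seq (Q * nonterminal G * Q + T)) :=
  match s with
  | [::] => if p == q then [:: [::]] else [::]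
  | inl A :: s' => [seq inl (p, A, m) :: t | m <- enum Q, t <- annotate m s' q]
  | inr a :: s' =>
      [seq nseq mb.2 (inr a) ++ t
        | mb : Q * bool <- delta p a, t : seq _ <- annotate mb.1 s' q]
  end.

Definition triple_cfg (p0 q0 : Q) : cfg T :=
  @Cfg T (Q * nonterminal G * Q)%type (p0, start G, q0)
    (flatten [seq [seq ((pq.1, Ar.1, pq.2), t) | t <- annotate pq.1 Ar.2 pq.2]
               | Ar <- productions G, pq <- enum {: Q * Q}]).

Variables p0 q0 : Q.

Lemma triple_productionsP p A q t :
  reflect (exists2 r, (A, r) \in productions G & t \in annotate p r q)
          ((p, A, q, t) \in productions (triple_cfg p0 q0)).
Proof.
apply: (iffP flattenP) => [[ts]|[r Ar tr]].
  move=> /allpairsP[[[B r] [p' q']] /= [Br _ ->]].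
  by move=> /mapP[t' t'r [-> -> -> ->]]; exists r.
exists [seq ((p, A, q), t') | t' <- annotate p r q].
  by apply/allpairsP; exists ((A, r), (p, q)); rewrite mem_enum.
by apply/mapP; exists t.
Qed.

(** The induction on the forest over [t] needs an inner induction on [s]: erased terminals of [s]
    leave no trace in [t], so any number of them may precede the symbol that [t] starts with. *)
Lemma yields_annotate p s q t out :
  t \in annotate p s q -> @yields T (triple_cfg p0 q0) t out ->
  exists2 w, yields s w & run p w q out.
Proof.
move=> ts y; elim: y p s q ts => {t out}.
- move=> p s; elim: s p => [|[A|a] s IH] p q /=.
  + by case: eqP => // -> _; exists [::] => //; constructor.
  + by move/allpairsPdep=> [m [t []]].
  + move/allpairsPdep=> [[m []] [t [d ts]]] //= et.
    move: ts; rewrite -et => /IH[w y r].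
    exists (a :: w); first by constructor.
    by exists m, false, [::].
- move=> a t out _ IHt p s; elim: s p => [|[A|b] s IH] p q /=.
  + by case: eqP.
  + by move/allpairsPdep=> [m [t' []]].
  + move/allpairsPdep=> [[m []] [t' [d ts]]] //= et.
      move: et d ts => [<- <-] d /IHt[w y r].
      exists (a :: w); first by constructor.
      by exists m, true, out.
    move: ts; rewrite -et => /IH[w y r].
    exists (b :: w); first by constructor.
    by exists m, false, (a :: out).
- move=> A' r' t o1 o2 Ar' _ IHr _ IHt p s; elim: s p => [|[A|b] s IH] p q /=.
  + by case: eqP.
  + move/allpairsPdep=> [m [t' [_ ts [eA et]]]].
    move: Ar' ts; rewrite eA -et => /triple_productionsP[r Ar /IHr[w1 y1 r1]].
    move=> /IHt[w2 y2 r2].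
    exists (w1 ++ w2); first exact: yields_nonterminal Ar y1 y2.
    exact: run_cat r1 r2.
  + move/allpairsPdep=> [[m []] [t' [d ts]]] //= et.
    move: ts; rewrite -et => /IH[w y r].
    exists (b :: w); first by constructor.
    by exists m, false, (o1 ++ o2).
Qed.

Lemma annotate_yields p s q w out : yields s w -> run p w q out ->
  exists2 t, t \in annotate p s q & @yields T (triple_cfg p0 q0) t out.
Proof.
move=> y; elim: y p q out => {s w} /=.
- by move=> p q out [-> ->]; exists [::]; rewrite ?eqxx ?inE //; constructor.
- move=> a s w _ IH p q out [m [b [out' [d /IH[t ts y] ->]]]].
  exists (nseq b (inr a) ++ t).
    by apply/allpairsPdep; exists (m, b), t.
  by case: b {d} => //=; constructor.
- move=> A r s w1 w2 Ar _ IHr _ IHs p q out.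
  (* The state to guess after [A] is the one that the run reaches at the end of [w1]. *)
  move=> /run_split[m [o1 [o2 [/IHr[t1 t1r y1] /IHs[t2 t2s y2] ->]]]].
  exists (inl (p, A, m) :: t2).
    by apply/allpairsPdep; exists m, t2; rewrite mem_enum.
  apply: yields_nonterminal y1 y2.
  by apply/triple_productionsP; exists r.
Qed.

End ErasingAutomaton.

Lemma context_free_run (T Q : finType) (delta : Q -> T -> seq (Q * bool))
    (p q : Q) (L : set (seq T)) :
  context_free L ->
  context_free [set out | exists2 w, L w & run delta p w q out].
Proof.
move=> [G ->]; apply: (@context_freeP _ (triple_cfg delta G p q)) => out.
(* The start symbols are expanded once, because [annotate] relates right-hand sides. *)
rewrite yields_single; split.
  move=> [w /cfg_languageE /yields_single[r Ar y] rw].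
  have [t tr yt] := annotate_yields p q y rw.
  by exists t => //; apply/triple_productionsP; exists r.
move=> [t /triple_productionsP[r Ar tr] /(yields_annotate tr)[w y rw]].
by exists w => //; apply/cfg_languageE/yields_single; exists r.
Qed.

(** * Selecting the parts before, at and after a marked letter *)

Section MarkedLetter.
Variables (T : finType) (a : T) (k0 ka k1 : bool).

Definition keep (b : bool) (w : seq T) : seq T := if b then w else [::].

(** State [true] means that the marked occurrence of [a] has been read. *)
Definition mark_delta (p : bool) (x : T) : seq (bool * bool) :=
  if p then [:: (true, k1)]
  else (false, k0) :: if x == a then [:: (true, ka)] else [::].

Lemma run_mark_after v out :
  run mark_delta true v true out <-> out = keep k1 v.
Proof.
elim: v out => [|x v IH] out /=; first by rewrite /keep if_same; split=> [[]|].
split=> [[m [b [o []]]]|->].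
  by rewrite inE => /eqP[-> ->] /IH-> ->; case: k1.
exists true, k1, (keep k1 v); rewrite inE eqxx; split=> //; first exact/IH.
by case: k1.
Qed.

(** State [false] may also pass over an [a], so every occurrence can be the marked one; ending in
    [true] forces exactly one to be marked. *)
Lemma run_markP w out : run mark_delta false w true out <->
  exists u v, w = u ++ a :: v /\
    out = keep k0 u ++ keep ka [:: a] ++ keep k1 v.
Proof.
elim: w out => [|x w IH] out /=.
  by split=> [[]|[[|? ?] [? []]]].
split=> [[m [b [o []]]]|[[|y u] [v /= [[-> ew] ->]]]].
- rewrite inE => /orP[/eqP[-> ->] /IH[u [v [-> ->]]] ->|].
    by exists (x :: u), v; split=> //; case: k0.
  case: eqP => // ->; rewrite inE => /eqP[-> ->] /run_mark_after-> ->.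
  by exists [::], w; split=> //; rewrite /keep; case: k0; case: ka.
- exists true, ka, (keep k1 v); rewrite inE eqxx inE eqxx orbT.
  split=> //; first by apply/run_mark_after; rewrite ew.
  by rewrite /keep; case: k0; case: ka.
- exists false, k0, (keep k0 u ++ keep ka [:: a] ++ keep k1 v).
  rewrite inE eqxx; split=> //; last by case: k0.
  by apply/IH; exists u, v.
Qed.

(** Three settings of the flags are used: all true for [containing], [true true false] for left
    factors ending in [a], and [false false true] for right factors. *)
Lemma context_free_mark (L : set (seq T)) : context_free L ->
  context_free [set keep k0 uv.1 ++ keep ka [:: a] ++ keep k1 uv.2
                 | uv in [set uv | L (uv.1 ++ a :: uv.2)]].
Proof.
move=> /(context_free_run mark_delta false true).
congr context_free; apply/predeqP => out; split.
  by move=> [w Lw /run_markP[u [v [ew ->]]]]; exists (u, v); rewrite //= -ew.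
move=> [[u v] /= Luv <-]; exists (u ++ a :: v) => //.
by apply/run_markP; exists u, v.
Qed.

End MarkedLetter.

(** * Decomposition of [GSA] by letters *)

Definition containing (T : finType) (a : T) (L : set (seq T)) : set (seq T) :=
  [set w | L w /\ a \in w].

Definition crossover (T : finType) (a : T) (L1 L2 : set (seq T)) :
    set (seq T) :=
  [set w | exists u1 v1 u2 v2, [/\ L1 (u1 ++ a :: v1), L2 (u2 ++ a :: v2)
                                 & w = u1 ++ a :: v2]].

Lemma context_free_containing (T : finType) (a : T) (L : set (seq T)) :
  context_free L -> context_free (containing a L).
Proof.
move=> /(context_free_mark a true true true); congr context_free.
apply/predeqP => w; split.
  by move=> [[u v] /= Luv <-]; split=> //; rewrite mem_cat inE eqxx orbT.
by move=> [Lw aw]; case: (splitPr aw) Lw => u v Luv; exists (u, v).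
Qed.

(** The conditions on the two factorizations are independent, so this is a product of languages. The
    left factor keeps the marked letter and the right one drops it, so that it appears once. *)
Lemma context_free_crossover (T : finType) (a : T) (L1 L2 : set (seq T)) :
  context_free L1 -> context_free L2 -> context_free (crossover a L1 L2).
Proof.
move=> /(context_free_mark a true true false) cf1.
move=> /(context_free_mark a false false true) cf2.
have := context_free_cat cf1 cf2; congr context_free; apply/predeqP => w; split.
  move=> [_ [[u1 v1] /= L1uv <-] [_ [[u2 v2] /= L2uv <-] <-]].
  by exists u1, v1, u2, v2; split=> //; rewrite -catA.
move=> [u1 [v1 [u2 [v2 [L1uv L2uv ->]]]]].
exists (u1 ++ [:: a]); first by exists (u1, v1).
by exists v2; [exists (u2, v2) | rewrite -catA].
Qed.

Lemma GSA_letterE (T : finType) (L1 L2 : set (seq T)) :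
  GSA L1 L2 = \bigcup_a
    ([set w | containing a L2 !=set0 /\ containing a L1 w] `|`
     [set w | containing a L1 !=set0 /\ containing a L2 w] `|`
     crossover a L1 L2 `|` crossover a L2 L1).
Proof.
have at_letter a u1 v1 u2 v2 w : L1 (u1 ++ a :: v1) -> L2 (u2 ++ a :: v2) ->
    w \in [:: u1 ++ a :: v1; u2 ++ a :: v2; u1 ++ a :: v2; u2 ++ a :: v1] ->
    GSA L1 L2 w.
  move=> L1w L2w win; exists (u1 ++ a :: v1) => //.
  exists (u2 ++ a :: v2) => //; exists [:: a].
    by split=> //; apply/infixP; [exists u1, v1 | exists u2, v2].
  by exists u1, v1, u2, v2.
have ain (u v : seq T) a : a \in u ++ a :: v by rewrite mem_cat inE eqxx orbT.
apply/predeqP => w; split.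
  (* The letter is the first one of the common factor, whose remainder [x] is moved into the right
     contexts. *)
  move=> [w1 L1w [w2 L2w [[|a x] [//= _ _ _]]]] [u1 [v1 [u2 [v2 [e1 e2]]]]].
  rewrite /= in e1 e2 *; rewrite {}e1 in L1w; rewrite {}e2 in L2w.
  rewrite !inE => /or4P[]/eqP->; exists a => //.
  - by left; left; left; split=> //; exists (u2 ++ a :: x ++ v2).
  - by left; left; right; split=> //; exists (u1 ++ a :: x ++ v1).
  - by left; right; exists u1, (x ++ v1), u2, (x ++ v2).
  - by right; exists u2, (x ++ v2), u1, (x ++ v1).
(* Conversely, [at_letter] takes the one-letter word [a] as common factor; for an uncrossed word,
   the guard supplies the partner. *)
move=> [a _ [[[]|]|]].
- move=> [[w2 [L2w /splitPr aw2]] [L1w /splitPr aw]].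
  case: aw2 L2w => u2 v2 L2w; case: aw L1w => u1 v1 L1w.
  by apply: at_letter L1w L2w _; rewrite !inE eqxx.
- move=> [[w1 [L1w /splitPr aw1]] [L2w /splitPr aw]].
  case: aw1 L1w => u1 v1 L1w; case: aw L2w => u2 v2 L2w.
  by apply: at_letter L1w L2w _; rewrite !inE eqxx ?orbT.
- move=> [u1 [v1 [u2 [v2 [L1w L2w ->]]]]].
  by apply: at_letter L1w L2w _; rewrite !inE eqxx ?orbT.
- move=> [u2 [v2 [u1 [v1 [L2w L1w ->]]]]].
  by apply: at_letter L1w L2w _; rewrite !inE eqxx ?orbT.
Qed.

Theorem theorem8 (T : finType) (L1 L2 : set (seq T))
    (cfL1 : context_free L1) (cfL2 : context_free L2) :
  context_free (GSA L1 L2).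
Proof.
rewrite GSA_letterE; apply: context_free_bigcup => a.
apply: context_free_setU; last exact: context_free_crossover.
apply: context_free_setU; last exact: context_free_crossover.
by apply: context_free_setU; apply: context_free_guard;
  apply: context_free_containing.
Qed.
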